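(* Let $v:[0,+\infty)\to\mathbb{R}$ be locally Lipschitz continuous, let $N\in\mathbb{N}$, $N\ge 1$, and let $X^0=(x_0^0,\ldots,x_N^0)\in\mathbb{R}^{N+1}$ with $x_0^0<x_1^0<\cdots<x_N^0$. Let $X(t)=(x_0(t),\ldots,x_N(t))$ be the (unique, a priori local-in-time) solution of the Follow-the-Leader system with $X(0)=X^0$, and let $$\overline{R}=\max_{i\in\{1,\ldots,N\}}R_i(0)=\frac{1}{N\min_{i\in\{1,\ldots,N\}}(x_i^0-x_{i-1}^0)}.$$ Then $X(t)$ exists globally in time and satisfies $$R_i(t)\le\overline{R}\qquad\text{for all }i\in\{1,\ldots,N\}\text{ and all }t\ge 0.$$
   Context: For a vector $X(t)=(x_0(t),\ldots,x_N(t))$ with $x_0(t)<\cdots<x_N(t)$ set $R_i(t)=\frac{1}{N(x_i(t)-x_{i-1}(t))}$, $i=1,\ldots,N$. The Follow-the-Leader system, posed on the open set of strictly increasing vectors of $\mathbb{R}^{N+1}$, is $$\dot x_0(t)=\min_{R\in[0,R_1(t)]}v(R),\qquad \dot x_N(t)=\max_{R\in[0,R_N(t)]}v(R),$$ and, for $i\in\{1,\ldots,N-1\}$, $$\dot x_i(t)=\begin{cases}\max_{R\in[R_{i+1}(t),R_i(t)]}v(R)&\text{if }R_i(t)\ge R_{i+1}(t),\\ \min_{R\in[R_i(t),R_{i+1}(t)]}v(R)&\text{if }R_i(t)<R_{i+1}(t).\end{cases}$$ The right-hand side is a locally Lipschitz function of $X$ on this open set, so the Cauchy problem has a unique local-in-time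 solution. *)

(* Defs.v *)
From mathcomp Require Import all_boot all_order all_algebra.
From mathcomp Require Import all_classical all_reals all_analysis.

Set Implicit Arguments.
Unset Strict Implicit.
Unset Printing Implicit Defensive.

Import Order.TTheory GRing.Theory Num.Theory.
Import numFieldNormedType.Exports.

Local Open Scope classical_set_scope.
Local Open Scope ring_scope.

(* States X = (x_0, ..., x_N) are row vectors with N + 1 entries; x_k is       *)
(* addressed by the natural number k, which is meaningful for k <= N only.     *)
Definition position (R : realType) (N : nat) (X : 'rV[R]_N.+1) (k : nat) : R :=
  X ord0 (inord k).

(* x_k - x_{k-1}, for 1 <= k <= N *)
Definition gap (R : realType) (N : nat) (X : 'rV[R]_N.+1) (k : nat) : R :=
  position X k - position X k.-1.

(* R_k, for 1 <= k <= N *)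
Definition density (R : realType) (N : nat) (X : 'rV[R]_N.+1) (k : nat) : R :=
  (N%:R * gap X k)^-1.

Definition increasing_state (R : realType) (N : nat) (X : 'rV[R]_N.+1) : Prop :=
  forall k : nat, (1 <= k <= N)%N -> position X k.-1 < position X k.

Definition max_on (R : realType) (v : R -> R) (a b : R) : R :=
  sup (v @` `[a, b]).

Definition min_on (R : realType) (v : R -> R) (a b : R) : R :=
  inf (v @` `[a, b]).

(* The supremum and infimum above are attained when v is continuous on [a, b], *)
(* so that they are the maximum and the minimum.                               *)
Lemma max_onP (R : realType) (v : R -> R) (a b : R) :
  a <= b -> {within `[a, b], continuous v} ->
  (v @` `[a, b]) (max_on v a b) /\ ubound (v @` `[a, b]) (max_on v a b).
Proof.
move=> ab cv; have [c cab cmax] := EVT_max ab cv.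
have ubc : ubound (v @` `[a, b]) (v c) by move=> _ [t tab <-]; exact: cmax.
have imc : (v @` `[a, b]) (v c) by exists c.
suff -> : max_on v a b = v c by [].
apply/le_anti/andP; split; first by apply: ge_sup => //; exists (v c).
by apply: ub_le_sup => //; exists (v c).
Qed.

Lemma min_onP (R : realType) (v : R -> R) (a b : R) :
  a <= b -> {within `[a, b], continuous v} ->
  (v @` `[a, b]) (min_on v a b) /\ lbound (v @` `[a, b]) (min_on v a b).
Proof.
move=> ab cv; have [c cab cmin] := EVT_min ab cv.
have lbc : lbound (v @` `[a, b]) (v c) by move=> _ [t tab <-]; exact: cmin.
have imc : (v @` `[a, b]) (v c) by exists c.
suff -> : min_on v a b = v c by [].
apply/le_anti/andP; split; first by apply: ge_inf => //; exists (v c).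
by apply: lb_le_inf => //; exists (v c).
Qed.

(* Speed of x_k in the Follow-the-Leader system; the first two cases exclude   *)
(* each other when N >= 1.                                                    *)
Definition ftl_speed (R : realType) (v : R -> R) (N : nat) (X : 'rV[R]_N.+1)
    (k : nat) : R :=
  if k == 0%N then min_on v 0 (density X 1)
  else if k == N then max_on v 0 (density X N)
  else if density X k.+1 <= density X k
    then max_on v (density X k.+1) (density X k)
    else min_on v (density X k) (density X k.+1).

(* f has derivative l at t relative to the set J: the increments are taken     *)
(* within J, hence the derivative is one-sided at an end point of J.           *)
Definition has_derivative_within (R : realType) (J : set R) (f : R -> R)
    (t l : R) : Prop :=
  (s - t)^-1 * (f s - f t) @[s --> within J t^'] --> l.

(* X solves on the time interval J (which contains 0) the Cauchy problem for   *)
(* the Follow-the-Leader system; the values of X outside J are irrelevant.     *)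
Definition ftl_solution (R : realType) (v : R -> R) (N : nat)
    (X0 : 'rV[R]_N.+1) (J : set R) (X : R -> 'rV[R]_N.+1) : Prop :=
  X 0 = X0 /\
  forall t, J t ->
    increasing_state (X t) /\
    forall k : nat, (k <= N)%N ->
      has_derivative_within J (fun s => position (X s) k) t (ftl_speed v (X t) k).

(* Main.v *)
Require Import Defs.
From mathcomp Require Import all_boot all_order all_algebra.
From mathcomp Require Import all_classical all_reals all_analysis.
From mathcomp Require Import ring lra.

Set Implicit Arguments.
Unset Strict Implicit.
Unset Printing Implicit Defensive.

Import Order.TTheory GRing.Theory Num.Theory.
Import numFieldNormedType.Exports.

Local Open Scope classical_set_scope.
Local Open Scope ring_scope.

(** The bound on the densities is a minimum principle for the gaps. Let [d] be
    the smallest initial gap, and suppose that a gap [x_k - x_(k-1)] has become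
    the smallest one, so that [R_k] is the largest density. Then the interval
    over which the speed of [x_k] is maximised contains [R_k], while the speed
    of [x_(k-1)] is a minimum over an interval containing [R_k] (or is [v R_k]
    itself). Hence the speeds satisfy [x_(k-1)' <= v R_k <= x_k'] and the gap
    cannot shrink ([ftl_speed_at_densest]).

    Global existence and the bound are obtained together by modifying the system
    away from the set of states whose gaps are all at least [d]. The map [spread]
    retracts all states onto this set by replacing each gap [g] by [max d g].
    On the set the densities stay in a compact interval, on which [v] is
    Lipschitz, and a maximum or minimum over an interval is a Lipschitz function
    of its end points; so the speeds precomposed with [spread] form a vector
    field that is Lipschitz on the whole space ([spread_field_lipschitz]). It has
    a global flow by Picard iteration ([velocity_field_flow]). Along this flow a
    gap below [d] is seen by the modified field as a gap equal to [d], that is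
    as a smallest gap, so it does not decrease ([small_gap_widens]); hence gaps
    that start at or above [d] remain so ([barrier]), the retraction acts
    trivially along the flow, and the flow solves the original system.

    For uniqueness, a solution [Y] on [[0, T[] has, by compactness, gaps
    bounded below on each [[0, b]] with [b < T]. Taking the smaller of this
    bound and [d] as the new threshold, [Y] and the global solution are both
    integral curves on [[0, b]] of one globally Lipschitz field, and they agree
    ([velocity_field_unique]).

    Existence and uniqueness for a field with Lipschitz constant [L] both rest on
    one estimate ([velocity_step]): if the velocities of two curves are the
    field along two other curves, the weighted distance
    [sup_t exp(- 2 L t) |U t - W t|] is halved. *)

(** * Local Lipschitz continuity on a compact interval *)

(** The local hypothesis bounds the increments near every pair of points of
    [[0, +oo[], off the diagonal as well as on it, so finitely many such bounds
    cover the compact square [[0, a] x [0, a]] of pairs. *)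
Lemma lipschitz_compact (R : realType) (v : R -> R) (a : R) :
  [locally [lipschitz v x | x in `[0, +oo[%classic]] ->
  exists2 L : R, 0 <= L &
    forall x y, 0 <= x <= a -> 0 <= y <= a -> `|v x - v y| <= L * `|x - y|.
Proof.
move=> hv.
have cK : compact (`[0, a]%classic `*` `[0, a]%classic).
  by apply: compact_setX; exact: segment_compact.
have near_pairs p : (`[0, a]%classic `*` `[0, a]%classic) p ->
    \forall q \near p & L \near +oo,
      (`[0, +oo[%classic `*` `[0, +oo[%classic) q ->
      `|v q.1 - v q.2| <= L * `|q.1 - q.2|.
  move=> [/= /itvP p1 /itvP p2].
  have /hv[M [_ HM]] : (`[0, +oo[%classic `*` `[0, +oo[%classic) p.
    by split; rewrite /= in_itv/= ?p1 ?p2.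
  have {HM}/HM HM : M < M + 1 by rewrite ltrDl.
  exists ([set q | (`[0, +oo[%classic `*` `[0, +oo[%classic) q ->
      `|v q.1 - v q.2| <= (M + 1) * `|q.1 - q.2|],
      [set L | M + 1 <= L]) => /=.
    by split; [exact: HM|apply: nbhs_pinfty_ge; exact: num_real].
  move=> [q L] [/= vq ML] Aq.
  by apply: (le_trans (vq Aq)); apply: ler_wpM2r.
have := (compact_near_coveringP _).1 cK _ _ _ _ near_pairs.
case=> M [_ HM].
(* M need not be nonnegative, and the cover works for every constant above M. *)
exists (Num.max (M + 1) 0); first by rewrite le_max lexx orbT.
move=> x y /andP[x0 xa] /andP[y0 ya].
have := HM (Num.max (M + 1) 0) _ (x, y); apply => //.
- by rewrite lt_max ltrDl ltr01.
- by split; rewrite /= in_itv/= ?x0 ?y0.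
- by split; rewrite /= in_itv/= ?x0 ?y0.
Qed.

(** * Sup norm, increments and geometric estimates *)

Section RowVectorNorm.
Variables (R : realType) (n : nat).
Implicit Types x : 'rV[R]_n.

Lemma norm_coord_le x k : `|x ord0 k| <= `|x|.
Proof.
rewrite [leRHS]/Num.Def.normr/= mx_normrE.
exact: (le_bigmax _ (fun ij => `|x ij.1 ij.2|) (ord0, k)).
Qed.

Lemma norm_row_le x (e : R) :
  0 <= e -> (forall k, `|x ord0 k| <= e) -> `|x| <= e.
Proof.
move=> e0 xe; rewrite [leLHS]/Num.Def.normr/= mx_normrE.
by apply: bigmax_le => //= -[i k] _ /=; rewrite ord1.
Qed.

Lemma cvg_row (T : Type) (G : set_system T) (FG : Filter G)
    (f : T -> 'rV[R]_n) (l : 'rV[R]_n) :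
  (forall k, f s ord0 k @[s --> G] --> l ord0 k) -> f @ G --> l.
Proof.
move=> fl; apply/cvgrPdist_le => /= e e0.
near=> s; apply: norm_row_le; first exact: ltW.
move=> k; rewrite !mxE; move: k; near: s; apply: filter_forall => k.
exact: ((cvgrPdist_le _ _).1 (fl k)).
Unshelve. all: by end_near. Qed.

End RowVectorNorm.

(** Only interior derivatives enter, so this applies to curves that have
    one-sided derivatives at the end points. *)
Lemma ger0_derive_le_increment (R : realType) (h dh : R -> R) (a b : R) :
  a <= b -> (forall t, a < t < b -> is_derive t 1 h (dh t)) ->
  {within `[a, b], continuous h} -> (forall t, a < t < b -> 0 <= dh t) ->
  h a <= h b.
Proof.
rewrite le_eqVlt => /predU1P[-> //|ab] hd hc dh0.
have hd' t : t \in `]a, b[ -> is_derive t 1 h (dh t).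
  by rewrite in_itv; exact: hd.
have [c /[!in_itv]/= cab hE] := MVT ab hd' hc.
by rewrite -subr_ge0 hE mulr_ge0 ?dh0// subr_ge0 ltW.
Qed.

(** Mean value inequality: [g - f] and [g + f] are both nondecreasing. *)
Lemma norm_increment_le (R : realType) (f g df dg : R -> R) (a b : R) :
  a <= b ->
  (forall t, a < t < b -> is_derive t 1 f (df t)) ->
  (forall t, a < t < b -> is_derive t 1 g (dg t)) ->
  {within `[a, b], continuous f} -> {within `[a, b], continuous g} ->
  (forall t, a < t < b -> `|df t| <= dg t) ->
  `|f b - f a| <= g b - g a.
Proof.
move=> ab fd gd fc gc le_fg.
have sub : (g - f) a <= (g - f) b.
  apply: (@ger0_derive_le_increment _ _ (dg - df)) => // [t tab||t tab].
  - by apply: is_deriveB; [exact: gd|exact: fd].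
  - by move=> s; apply: cvgB; [exact: gc|exact: fc].
  - by rewrite /= subr_ge0 (le_trans (ler_norm _)) ?le_fg.
have add : (g + f) a <= (g + f) b.
  apply: (@ger0_derive_le_increment _ _ (dg + df)) => // [t tab||t tab].
  - by apply: is_deriveD; [exact: gd|exact: fd].
  - by move=> s; apply: cvgD; [exact: gc|exact: fc].
  - by have := le_fg _ tab; rewrite /= ler_norml => /andP[]; rewrite fctE; lra.
by move: sub add; rewrite !fctE ler_norml; lra.
Qed.

Lemma cvg_div_exp2 (R : realType) (C : R) : C / 2 ^+ n @[n --> \oo] --> 0.
Proof.
have -> : (fun n => C / 2 ^+ n) = geometric C 2^-1.
  by apply/funext => n; rewrite /= exprVn.
by apply: cvg_geometric; rewrite ger0_norm; lra.
Qed.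

Lemma le0_of_le_div_exp2 (R : realType) (x C : R) :
  (forall n, x <= C / 2 ^+ n) -> x <= 0.
Proof.
move=> xC; apply: (cvgr_to_ge (cvg_div_exp2 C)).
by apply: nearW => n; exact: xC.
Qed.

(** The explicit rate gives bounds that are uniform in time when [u] is a
    sequence of curves evaluated at a time on which [C] depends boundedly. *)
Lemma cvg_of_geometric_steps (R : realType) (d : nat)
    (u : nat -> 'rV[R]_d) (C : R) :
  (forall n, `|u n.+1 - u n| <= C / 2 ^+ n) ->
  exists l, forall n, `|l - u n| <= 2 * C / 2 ^+ n.
Proof.
move=> uC; have C0 : 0 <= C.
  by have := uC 0; rewrite expr0 divr1; exact: le_trans.
have tail n m : `|u (n + m)%N - u n| <= 2 * C / 2 ^+ n - 2 * C / 2 ^+ (n + m).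
  elim: m => [|m IH]; first by rewrite addn0 !subrr normr0.
  rewrite addnS -(subrKA (u (n + m)%N)) (le_trans (ler_normD _ _))//.
  apply: (le_trans (lerD (uC _) IH)).
  have -> : 2 * C / 2 ^+ (n + m).+1 = C / 2 ^+ (n + m).
    by rewrite exprS invfM; field.
  by rewrite le_eqVlt; apply/orP; left; apply/eqP; ring.
have tail' n m : (n <= m)%N -> `|u m - u n| <= 2 * C / 2 ^+ n.
  move=> /subnKC <-; apply: (le_trans (tail _ _)).
  by rewrite lerBlDr lerDl !mulr_ge0// invr_ge0 exprn_ge0.
have u_cvg : cvg (u @ \oo).
  apply/cauchy_cvgP/cauchy_exP => e e0.
  have /cvgrPdist_lt/(_ _ e0)[N _ HN] := cvg_div_exp2 (2 * C).
  exists (u N); exists N => // m /= Nm; rewrite -ball_normE /= distrC.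
  apply: (le_lt_trans (tail' _ _ Nm)); have := HN N (leqnn N).
  by rewrite sub0r normrN; apply: le_lt_trans; exact: ler_norm.
exists (lim (u @ \oo)) => n.
apply: (cvgr_to_le (cvg_norm (cvgB u_cvg (cvg_cst (u n))))).
by exists n => // m /= nm; exact: tail'.
Qed.

(** * Uniqueness for globally Lipschitz vector fields *)

Section CauchyProblem.
Variables (R : realType) (n : nat).
Implicit Types (U W u w : R -> 'rV[R]_n) (b t : R).

(** Velocities are prescribed in the open interval only; with continuity on the
    closed one this is the form shared by the curves with one-sided derivatives
    at [0] and by those that are differentiable on both sides. *)
Definition moves_with b U u : Prop :=
  forall k, {within `[0, b], continuous (fun s => U s ord0 k)} /\
    forall t, 0 < t < b -> is_derive t 1 (fun s => U s ord0 k) (u t ord0 k).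

Lemma moves_withW b b' U u : b' <= b -> moves_with b U u -> moves_with b' U u.
Proof.
move=> b'b Uu k; have [Uc Ud] := Uu k; split.
  by apply: continuous_subspaceW Uc; apply: subset_itvl; rewrite bnd_simp.
by move=> t /andP[t0 tb']; apply: Ud; rewrite t0 (lt_le_trans tb').
Qed.

Lemma is_derive_weight (C K t : R) : K != 0 ->
  is_derive t 1 (fun s => C / K * expR (K * s)) (C * expR (K * t)).
Proof.
move=> K0.
have dl : is_derive t 1 (fun s : R => K * s) K.
  by apply: is_derive_eq; rewrite /GRing.scale/= mulr1.
have de : is_derive t 1 (fun s => expR (K * s)) (K * expR (K * t)).
  by apply: is_derive_eq; rewrite /GRing.scale/= mulrC.
apply: is_derive_eq; rewrite /GRing.scale/=; field.
exact: K0.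
Qed.

(** The weight [expR (K * t)] is multiplied by [K] under differentiation, hence
    integrating a bound by this weight gains a factor [K^-1]. *)
Lemma dist_le_of_velocity_dist (C K b : R) U W u w :
  0 < K -> 0 <= C -> 0 <= b -> U 0 = W 0 ->
  moves_with b U u -> moves_with b W w ->
  (forall t, 0 < t < b -> `|u t - w t| <= C * expR (K * t)) ->
  `|U b - W b| <= C / K * expR (K * b).
Proof.
move=> K0 C0 b0 UW0 Uu Ww uw.
have CK0 : 0 <= C / K by rewrite divr_ge0// ltW.
apply: norm_row_le => [|k]; first by rewrite mulr_ge0// expR_ge0.
have [Uc Ud] := Uu k; have [Wc Wd] := Ww k.
pose f := (fun s => U s ord0 k) - (fun s => W s ord0 k).
pose g s := C / K * expR (K * s).
have gd t : is_derive t 1 g (C * expR (K * t)).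
  by apply: is_derive_weight; rewrite gt_eqF.
have : `|f b - f 0| <= g b - g 0.
  apply: (@norm_increment_le _ _ _ (fun t => u t ord0 k - w t ord0 k)
    (fun t => C * expR (K * t))) => //.
  - by move=> t tb; apply: is_deriveB; [exact: Ud|exact: Wd].
  - by move=> s; apply: cvgB; [exact: Uc|exact: Wc].
  - apply: derivable_within_continuous => t _; exact: ex_derive.
  - move=> t tb; have := norm_coord_le (u t - w t) k.
    by rewrite !mxE => /le_trans; apply; exact: uw.
rewrite /f !fctE UW0 subrr subr0 !mxE => /le_trans; apply.
by rewrite /g mulr0 expR0 mulr1 gerBl.
Qed.

Lemma moves_with_dist_bounded b U W u w : 0 <= b ->
  moves_with b U u -> moves_with b W w ->
  exists2 C, 0 <= C & forall t, 0 <= t <= b -> `|U t - W t| <= C.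
Proof.
move=> b0 Uu Ww.
have coord_bound k : exists M, forall t, 0 <= t <= b ->
    `|(U t - W t) ord0 k| <= M.
  have [Uc _] := Uu k; have [Wc _] := Ww k.
  have cd : {within `[0, b], continuous
      (fun s => `|(U s ord0 k : R) - W s ord0 k|)}.
    by move=> s; apply: cvg_norm; apply: cvgB; [exact: Uc|exact: Wc].
  have [c _ cmax] := EVT_max b0 cd.
  by eexists => t tb; rewrite !mxE; apply: cmax; rewrite in_itv.
have [M HM] := choice coord_bound.
have C0 : 0 <= \big[Num.max/0]_k M k by rewrite bigmax_idl le_max lexx.
exists (\big[Num.max/0]_k M k) => // t tb.
apply: norm_row_le => // k; apply: (le_trans (HM k t tb)).
exact: le_bigmax.
Qed.

Variables (F : 'rV[R]_n -> 'rV[R]_n) (L : R).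
Hypothesis L0 : 0 < L.
Hypothesis lipF : forall x y, `|F x - F y| <= L * `|x - y|.

Let K := 2 * L.
Let K0 : 0 < K. Proof. by rewrite mulr_gt0. Qed.

(** The contraction behind both existence and uniqueness: the Lipschitz constant
    [L] is beaten by the gain [K^-1] of one integration, since [K = 2 L]. *)
Lemma velocity_step (C b : R) U W U' W' : 0 <= C -> 0 <= b -> U 0 = W 0 ->
  moves_with b U (F \o U') -> moves_with b W (F \o W') ->
  (forall t, 0 <= t <= b -> `|U' t - W' t| <= C * expR (K * t)) ->
  `|U b - W b| <= C / 2 * expR (K * b).
Proof.
move=> C0 b0 UW0 UU' WW' UW'.
have -> : C / 2 = L * C / K by rewrite /K; field; rewrite gt_eqF.
apply: (dist_le_of_velocity_dist K0 _ b0 UW0 UU' WW').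
  by rewrite mulr_ge0// ltW.
move=> t /andP[t0 tb]; apply: (le_trans (lipF _ _)).
by rewrite -mulrA ler_wpM2l ?UW' ?(ltW t0) ?(ltW tb)// ltW.
Qed.

(** Two integral curves are at bounded distance on a compact interval; using
    them as their own input in [velocity_step] halves the bound for ever. *)
Lemma velocity_field_unique b U W : 0 <= b -> U 0 = W 0 ->
  moves_with b U (F \o U) -> moves_with b W (F \o W) -> U b = W b.
Proof.
move=> b0 UW0 UU WW.
have [C C0 UWC] := moves_with_dist_bounded b0 UU WW.
have bound m t : 0 <= t <= b -> `|U t - W t| <= C / 2 ^+ m * expR (K * t).
  elim: m t => [|m IH] t tb.
    rewrite expr0 divr1 (le_trans (UWC _ tb))// ler_peMr// -expR0 ler_expR.
    by rewrite mulr_ge0 ?(ltW K0)//; case/andP: tb.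
  have /andP[t0 tb'] := tb.
  rewrite exprSr invfM mulrA.
  apply: (velocity_step _ t0 UW0 (moves_withW tb' UU) (moves_withW tb' WW)).
    by rewrite divr_ge0// exprn_ge0.
  by move=> s /andP[s0 st]; rewrite IH// s0 (le_trans st).
have : `|U b - W b| <= 0.
  apply: (@le0_of_le_div_exp2 _ _ (C * expR (K * b))) => m.
  by rewrite mulrAC bound// b0 lexx.
by rewrite normr_le0 subr_eq0 => /eqP.
Qed.

End CauchyProblem.

(** * Global flow of a globally Lipschitz vector field *)

Section PicardIteration.
Variable R : realType.

(** Integrating from [-1], to the left of the origin, makes the primitive
    differentiable on both sides at time [0] too. *)
Definition primitive (f : R -> R) (t : R) : R :=
  \int[lebesgue_measure]_(s in `[-1, t]) f s -
  \int[lebesgue_measure]_(s in `[-1, 0]) f s.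

Lemma primitive0 (f : R -> R) : primitive f 0 = 0.
Proof. exact: subrr. Qed.

Lemma is_derive_primitive (f : R -> R) (t : R) : continuous f -> 0 <= t ->
  is_derive t 1 (primitive f) (f t).
Proof.
move=> fc t0.
have t1 : -1 < t by rewrite (lt_le_trans _ t0)// ltrN10.
have tt1 : t < t + 1 by rewrite ltrDl.
have fi : lebesgue_measure.-integrable `[-1, t + 1] (EFin \o f).
  apply: continuous_compact_integrable; first exact: segment_compact.
  exact: continuous_subspaceT.
pose I (y : R) : R := \int[lebesgue_measure]_(s in `[-1, y]) f s.
have [d dE] : derivable I t 1 /\ derive1 I t = f t.
  exact: continuous_FTC1_closed tt1 fi t1 (fc t).
have -> : primitive f = I - cst (I 0) by [].
move: (I 0) => c; clearbody I.
have dI : is_derive t 1 I (f t) by rewrite -dE derive1E; exact: derivableP.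
by have := is_deriveB dI (is_derive_cst c t 1); rewrite subr0.
Qed.

Variables (n : nat) (F : 'rV[R]_n -> 'rV[R]_n) (L : R).
Hypothesis L0 : 0 < L.
Hypothesis lipF : forall x y, `|F x - F y| <= L * `|x - y|.

Let K := 2 * L.
Let K0 : 0 < K. Proof. by rewrite mulr_gt0. Qed.

Lemma lipschitz_field_continuous : continuous F.
Proof.
move=> x; apply/(@cvgrPdist_le _ _ _ (nbhs x)) => e e0.
have /cvgrPdist_le near_x : id @ x --> x := @cvg_id _ (nbhs x).
near=> y; apply: (le_trans (lipF _ _)).
rewrite mulrC -ler_pdivlMr//; near: y.
by apply: near_x; rewrite divr_gt0.
Unshelve. all: by end_near. Qed.

Implicit Types (x : 'rV[R]_n) (U : R -> 'rV[R]_n) (t b : R).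

(** The curve [U] is read at [Num.max s 0], so that the integrand is continuous
    on the whole line although only the values of [U] at nonnegative times are
    under control. *)
Definition picard (x0 : 'rV[R]_n) (U : R -> 'rV[R]_n) (t : R) : 'rV[R]_n :=
  x0 + \row_k primitive (fun s => F (U (Num.max s 0)) ord0 k) t.

Definition continuous_forward (U : R -> 'rV[R]_n) : Prop :=
  forall t, 0 <= t -> {for t, continuous U}.

Lemma continuous_forward_max (U : R -> 'rV[R]_n) :
  continuous_forward U -> continuous (fun s : R => U (Num.max s 0)).
Proof.
move=> Uc s.
apply: (@continuous_comp _ _ _ (fun s : R => Num.max s 0) U); last first.
  by apply: Uc; rewrite le_max lexx orbT.
by apply: continuous_max; [exact: cvg_id|exact: cvg_cst].
Qed.

Lemma picard_derive x0 U t k :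
  continuous (fun s : R => U (Num.max s 0)) -> 0 <= t ->
  is_derive t 1 (fun s => picard x0 U s ord0 k) (F (U t) ord0 k).
Proof.
move=> Uc t0.
have -> : (fun s => picard x0 U s ord0 k) =
    cst (x0 ord0 k) + primitive (fun s => F (U (Num.max s 0)) ord0 k).
  by apply/funext => s; rewrite /picard !mxE.
have Fc : continuous (fun s : R => F (U (Num.max s 0)) ord0 k).
  move=> s; apply: (@continuous_comp _ _ _ _ (fun x : 'rV[R]_n => x ord0 k)).
    apply: (@continuous_comp _ _ _ (fun s : R => U (Num.max s 0)) F).
      exact: Uc.
    exact: lipschitz_field_continuous.
  exact: coord_continuous.
have := is_derive_primitive Fc t0; rewrite max_l// => dP.
by apply: is_derive_eq; rewrite add0r.
Qed.

Lemma picard_continuous x0 U : continuous (fun s : R => U (Num.max s 0)) ->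
  continuous_forward (picard x0 U).
Proof.
move=> Uc t t0; apply: cvg_row => k.
have dP := picard_derive x0 k Uc t0.
apply: (@differentiable_continuous _ _ _ _ (fun s => picard x0 U s ord0 k)).
exact/derivable1_diffP/ex_derive.
Qed.

Lemma picard0 x0 U : picard x0 U 0 = x0.
Proof. by apply/rowP => k; rewrite !mxE primitive0 addr0. Qed.

Lemma picard_moves_with x0 U b : continuous (fun s : R => U (Num.max s 0)) ->
  moves_with b (picard x0 U) (F \o U).
Proof.
move=> Uc k; split=> [|t /andP[t0 _]]; last exact: picard_derive (ltW t0).
apply: derivable_within_continuous => t /[!in_itv]/= /andP[t0 _].
by have ? := picard_derive x0 k Uc t0; exact: ex_derive.
Qed.

Definition picard_seq (x0 : 'rV[R]_n) (m : nat) : R -> 'rV[R]_n :=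
  iter m (picard x0) (cst x0).

Lemma picard_seq0 x0 m : picard_seq x0 m 0 = x0.
Proof. by case: m => // m; exact: picard0. Qed.

Lemma picard_seq_continuous x0 m :
  continuous (fun s : R => picard_seq x0 m (Num.max s 0)).
Proof.
elim: m => [|m IH]; first by move=> s; exact: cvg_cst.
exact: continuous_forward_max (picard_continuous IH).
Qed.

Lemma picard_seq_moves_with x0 m b :
  moves_with b (picard_seq x0 m.+1) (F \o picard_seq x0 m).
Proof.
apply: (@picard_moves_with x0 (picard_seq x0 m)).
exact: (@picard_seq_continuous x0 m).
Qed.

(** For the first step the velocities are the constant [F x0] and [0]; the
    later steps halve the bound by [velocity_step]. *)
Lemma picard_seq_step x0 m t : 0 <= t ->
  `|picard_seq x0 m.+1 t - picard_seq x0 m t| <=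
    `|F x0| / K / 2 ^+ m * expR (K * t).
Proof.
elim: m t => [|m IH] t t0.
  rewrite expr0 divr1.
  apply: (@dist_le_of_velocity_dist _ _ _ K _ _ _ (F \o cst x0) (fun=> 0)) => //.
  - exact: picard_seq0.
  - by apply: picard_moves_with => s; exact: cvg_cst.
  - move=> k; split; first by move=> s; exact: cvg_cst.
    by move=> s _; rewrite mxE; exact: is_derive_cst.
  - move=> s /andP[s0 _]; rewrite subr0 ler_peMr// -expR0 ler_expR.
    by rewrite mulr_ge0// ltW.
rewrite exprSr [(_ ^+ m * 2)^-1]invfM mulrA.
apply: (@velocity_step _ _ _ _ L0 lipF _ _ _ _
  (picard_seq x0 m.+1) (picard_seq x0 m) _ t0) => //.
- by rewrite !divr_ge0// ltW.
- by rewrite !picard_seq0.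
- exact: picard_seq_moves_with.
- exact: picard_seq_moves_with.
- by move=> s /andP[s0 _]; exact: IH.
Qed.

(** The iterates converge pointwise to a curve [X], which is continuous because
    the convergence is locally uniform. The integral curve is [picard x0 X]
    rather than [X], as [X] is an arbitrary choice at negative times; the two
    agree at nonnegative times, since [picard] contracts the distance of [X] to
    the iterates. *)
Lemma velocity_field_flow x0 : exists Z : R -> 'rV[R]_n,
  Z 0 = x0 /\ forall t k, 0 <= t ->
    is_derive t 1 (fun s => Z s ord0 k) (F (Z t) ord0 k).
Proof.
pose C := 2 * (`|F x0| / K).
have C0 : 0 <= C by rewrite mulr_ge0// divr_ge0// ltW.
have lim_ex t : exists l, 0 <= t ->
    forall m, `|l - picard_seq x0 m t| <= C / 2 ^+ m * expR (K * t).
  have [t0|_] := boolP (0 <= t); last by exists 0.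
  have [|l Hl] := @cvg_of_geometric_steps R n
      (fun m => picard_seq x0 m t) (`|F x0| / K * expR (K * t)).
    by move=> m; rewrite mulrAC picard_seq_step.
  exists l => _ m; apply: (le_trans (Hl m)).
  by rewrite le_eqVlt /C; apply/orP; left; apply/eqP; ring.
have [X HX] := choice lim_ex.
have Xc : continuous (fun s : R => X (Num.max s 0)).
  move=> t; apply/(@cvgrPdist_le _ _ _ (nbhs t)) => e e0.
  (* The weight is bounded by expR (K * B) up to time t + 1. *)
  pose B := Num.max t 0 + 1.
  have [m Hm] : exists m, C * expR (K * B) / 2 ^+ m <= e / 3.
    have /cvgrPdist_le/(_ (e / 3)) := cvg_div_exp2 (C * expR (K * B)).
    have e3 : 0 < e / 3 by rewrite divr_gt0.
    move=> /(_ e3)[m _ Hm]; exists m; apply: le_trans (Hm m (leqnn m)).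
    by rewrite sub0r normrN ler_norm.
  have close s : s <= B ->
      `|X (Num.max s 0) - picard_seq x0 m (Num.max s 0)| <= e / 3.
    move=> sB; have s0 : 0 <= Num.max s 0 by rewrite le_max lexx orbT.
    apply: (le_trans (HX _ s0 m)); apply: le_trans Hm.
    rewrite [leRHS]mulrAC ler_wpM2l//; first by rewrite divr_ge0// exprn_ge0.
    rewrite ler_expR ler_pM2l// ge_max sB/=.
    by rewrite /B addr_ge0// le_max lexx orbT.
  have /(@cvgrPdist_le _ _ _ (nbhs t)) near_seq := @picard_seq_continuous x0 m t.
  near=> s.
  have sB : s <= B.
    apply: ltW; near: s; apply: lt_nbhsl.
    by rewrite (@le_lt_trans _ _ (Num.max t 0)) ?le_max ?lexx// ltrDl.
  have tB : t <= B.
    by rewrite (@le_trans _ _ (Num.max t 0)) ?le_max ?lexx// lerDl.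
  have pc : `|picard_seq x0 m (Num.max t 0) - picard_seq x0 m (Num.max s 0)| <= e / 3.
    by near: s; apply: near_seq; rewrite divr_gt0.
  have tc := close _ tB; have := close _ sB; rewrite distrC => sc.
  have -> : e = e / 3 + (e / 3 + e / 3) by field.
  rewrite -(subrKA (picard_seq x0 m (Num.max t 0))) (le_trans (ler_normD _ _))//.
  rewrite lerD//.
  rewrite -(subrKA (picard_seq x0 m (Num.max s 0))) (le_trans (ler_normD _ _))//.
  exact: lerD.
have fixed t : 0 <= t -> picard x0 X t = X t.
  move=> t0; apply/eqP; rewrite -subr_eq0 -normr_le0.
  apply: (@le0_of_le_div_exp2 _ _ (C * expR (K * t))) => m.
  rewrite -(subrKA (picard_seq x0 m.+1 t)) (le_trans (ler_normD _ _))//.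
  have d1 : `|picard x0 X t - picard_seq x0 m.+1 t| <=
      C / 2 ^+ m / 2 * expR (K * t).
    apply: (@velocity_step _ _ _ _ L0 lipF _ _ _ _ X (picard_seq x0 m) _ t0).
    - by rewrite divr_ge0// exprn_ge0.
    - by rewrite picard0 picard_seq0.
    - exact: picard_moves_with.
    - exact: picard_seq_moves_with.
    - by move=> s /andP[s0 _]; exact: HX.
  have := HX t t0 m.+1; rewrite distrC => d2.
  apply: (le_trans (lerD d1 d2)).
  by rewrite exprSr invfM le_eqVlt; apply/orP; left; apply/eqP; field.
exists (picard x0 X); split=> [|t k t0]; first exact: picard0.
by rewrite fixed//; exact: picard_derive.
Unshelve. all: by end_near. Qed.

End PicardIteration.

(** * Maxima and minima over an interval depend Lipschitz continuously on it *)

Section SpeedEnvelope.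
Variables (R : realType) (A L : R).
Implicit Types (v : R -> R) (a b r s e : R).

Definition lipschitz_to v : Prop :=
  forall x y, 0 <= x <= A -> 0 <= y <= A -> `|v x - v y| <= L * `|x - y|.

Hypothesis L0 : 0 <= L.

Lemma lipschitz_to_continuous v a b : lipschitz_to v -> 0 <= a -> b <= A ->
  {within `[a, b], continuous v}.
Proof.
move=> lipv a0 bA; apply/subspace_continuousP => x /= /[!in_itv]/= /andP[ax xb].
apply/(@cvgrPdist_le _ _ _ _ (within_filter _ (nbhs_filter x))) => e e0.
have L1 : 0 < L + 1 by rewrite ltr_wpDl.
have /cvgrPdist_le near_x : id @ x --> x := @cvg_id _ (nbhs x).
have {}near_x := near_x (e / (L + 1)) (divr_gt0 e0 L1).
rewrite near_withinE; apply: filterS near_x => y xy.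
rewrite /= in_itv/= => /andP[ay yb].
apply: (@le_trans _ _ (L * `|x - y|)).
  by apply: lipv; rewrite ?(le_trans a0)//= (le_trans _ bA).
apply: (@le_trans _ _ ((L + 1) * `|x - y|)).
  by rewrite ler_wpM2r// lerDl.
by rewrite mulrC -ler_pdivlMr.
Qed.

Lemma lipschitz_toN v : lipschitz_to v -> lipschitz_to (fun x => - v x).
Proof. by move=> lipv x y xA yA; rewrite -opprD normrN; exact: lipv. Qed.

Lemma max_on_attained v a b : lipschitz_to v -> 0 <= a -> a <= b -> b <= A ->
  exists2 c, a <= c <= b & v c = max_on v a b.
Proof.
move=> lipv a0 ab bA.
have [[c cab vc] _] := max_onP ab (lipschitz_to_continuous lipv a0 bA).
by exists c => //; move: cab; rewrite /= in_itv.
Qed.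

Lemma le_max_on v a b c : lipschitz_to v -> 0 <= a -> b <= A ->
  a <= c <= b -> v c <= max_on v a b.
Proof.
move=> lipv a0 bA /andP[ac cb].
have [_ +] := max_onP (le_trans ac cb) (lipschitz_to_continuous lipv a0 bA).
by apply; exists c => //; rewrite /= in_itv/= ac.
Qed.

Lemma min_on_attained v a b : lipschitz_to v -> 0 <= a -> a <= b -> b <= A ->
  exists2 c, a <= c <= b & v c = min_on v a b.
Proof.
move=> lipv a0 ab bA.
have [[c cab vc] _] := min_onP ab (lipschitz_to_continuous lipv a0 bA).
by exists c => //; move: cab; rewrite /= in_itv.
Qed.

Lemma min_on_le v a b c : lipschitz_to v -> 0 <= a -> b <= A ->
  a <= c <= b -> min_on v a b <= v c.
Proof.
move=> lipv a0 bA /andP[ac cb].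
have [_ +] := min_onP (le_trans ac cb) (lipschitz_to_continuous lipv a0 bA).
by apply; exists c => //; rewrite /= in_itv/= ac.
Qed.

(** Projecting [c] onto [[a', b']] moves it no further than the end points
    moved. *)
Lemma clamp_close a b a' b' e c : a' <= b' -> `|a - a'| <= e -> `|b - b'| <= e ->
  a <= c <= b -> exists2 c', a' <= c' <= b' & `|c - c'| <= e.
Proof.
move=> ab' aa' bb' /andP[ac cb].
move: aa' bb'; rewrite !ler_norml => /andP[h1 h2] /andP[h3 h4].
have [ca'|ca'] := leP c a'.
  by exists a'; rewrite ?lexx// ler_norml; apply/andP; split; lra.
have [cb'|cb'] := leP b' c.
  by exists b'; rewrite ?lexx ?ab'// ler_norml; apply/andP; split; lra.
by exists c; rewrite ?(ltW ca') ?(ltW cb')// subrr normr0; lra.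
Qed.

(** A maximum point over [[a, b]] projected onto [[a', b']] loses at most
    [L * e]. *)
Lemma max_on_perturb v a b a' b' e : lipschitz_to v ->
  0 <= a -> a <= b -> b <= A -> 0 <= a' -> a' <= b' -> b' <= A ->
  `|a - a'| <= e -> `|b - b'| <= e -> max_on v a b <= max_on v a' b' + L * e.
Proof.
move=> lipv a0 ab bA a0' ab' bA' aa' bb'.
have [c cab <-] := max_on_attained lipv a0 ab bA.
have [c' cab' cc'] := clamp_close ab' aa' bb' cab.
apply: (le_trans _ (lerD (le_max_on lipv a0' bA' cab') (lexx _))).
rewrite -lerBlDl (le_trans (ler_norm _))//.
have /andP[ac cb] := cab; have /andP[ac' cb'] := cab'.
rewrite (@le_trans _ _ (L * `|c - c'|)) ?ler_wpM2l//.
apply: lipv; first by rewrite (le_trans a0 ac) (le_trans cb bA).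
by rewrite (le_trans a0' ac') (le_trans cb' bA').
Qed.

Lemma max_on_lipschitz v a b a' b' e : lipschitz_to v ->
  0 <= a -> a <= b -> b <= A -> 0 <= a' -> a' <= b' -> b' <= A ->
  `|a - a'| <= e -> `|b - b'| <= e ->
  `|max_on v a b - max_on v a' b'| <= L * e.
Proof.
move=> lipv a0 ab bA a0' ab' bA' aa' bb'.
have h1 := max_on_perturb lipv a0 ab bA a0' ab' bA' aa' bb'.
rewrite distrC in aa'; rewrite distrC in bb'.
have h2 := max_on_perturb lipv a0' ab' bA' a0 ab bA aa' bb'.
by rewrite ler_norml; apply/andP; split; lra.
Qed.

Lemma min_onE v a b : min_on v a b = - max_on (fun x => - v x) a b.
Proof. by rewrite /min_on /max_on /inf image_comp. Qed.

Lemma min_on_lipschitz v a b a' b' e : lipschitz_to v ->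
  0 <= a -> a <= b -> b <= A -> 0 <= a' -> a' <= b' -> b' <= A ->
  `|a - a'| <= e -> `|b - b'| <= e ->
  `|min_on v a b - min_on v a' b'| <= L * e.
Proof.
move=> lipv a0 ab bA a0' ab' bA' aa' bb'; rewrite !min_onE -opprD normrN.
exact: max_on_lipschitz (lipschitz_toN lipv) a0 ab bA a0' ab' bA' aa' bb'.
Qed.

(** The speed of an inner vehicle as a function of the density [r] behind it and
    the density [s] in front of it. *)
Definition interface_speed v r s : R :=
  if s <= r then max_on v s r else min_on v r s.

(** The two formulas agree on the diagonal [r = s]. If [s <= r] but [r' < s'],
    then every point of [[s, r]] is within [e] of every point of [[r', s']],
    because [e] bounds the displacements that reversed the order; so no detour
    through the diagonal is needed. *)
Lemma interface_speed_lipschitz v r s r' s' e : lipschitz_to v ->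
  0 <= r <= A -> 0 <= s <= A -> 0 <= r' <= A -> 0 <= s' <= A ->
  `|r - r'| <= e -> `|s - s'| <= e ->
  `|interface_speed v r s - interface_speed v r' s'| <= L * e.
Proof.
move=> lipv /andP[r0 rA] /andP[s0 sA] /andP[r0' rA'] /andP[s0' sA'] rr' ss'.
have mixed p q p' q' : 0 <= q -> q <= p -> p <= A -> 0 <= p' -> p' <= q' -> q' <= A ->
    `|p - p'| <= e -> `|q - q'| <= e ->
    `|max_on v q p - min_on v p' q'| <= L * e.
  move=> q0 qp pA p0' pq' qA' pp' qq'.
  have [c /andP[qc cp] <-] := max_on_attained lipv q0 qp pA.
  have [c' /andP[pc' cq'] <-] := min_on_attained lipv p0' pq' qA'.
  rewrite (@le_trans _ _ (L * `|c - c'|))//.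
    apply: lipv; first by rewrite (le_trans q0 qc) (le_trans cp pA).
    by rewrite (le_trans p0' pc') (le_trans cq' qA').
  rewrite ler_wpM2l//; move: pp' qq'; rewrite !ler_norml => /andP[h1 h2] /andP[h3 h4].
  by apply/andP; split; lra.
rewrite /interface_speed; have [sr|rs] := leP s r; have [sr'|rs'] := leP s' r'.
- exact: max_on_lipschitz.
- by apply: mixed => //; exact: ltW.
- rewrite distrC; apply: mixed => //; first exact: ltW.
  - by rewrite distrC.
  - by rewrite distrC.
- by apply: min_on_lipschitz => //; exact: ltW.
Qed.

End SpeedEnvelope.

(** * The Follow-the-Leader field on states with gaps bounded below *)

Section FollowTheLeaderField.
Variables (R : realType) (N : nat).
Hypothesis N1 : (1 <= N)%N.
Implicit Types (X Y : 'rV[R]_N.+1) (v : R -> R) (d : R) (k : nat).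

Let NR : 0 < N%:R :> R. Proof. by rewrite ltr0n. Qed.

Definition gaps_at_least d X : Prop :=
  forall k, (1 <= k <= N)%N -> d <= gap X k.

Lemma density_le d X k : 0 < d -> d <= gap X k -> density X k <= (N%:R * d)^-1.
Proof.
move=> d0 dX; rewrite /density lef_pV2 ?posrE ?mulr_gt0//.
  by rewrite ler_pM2l.
exact: lt_le_trans dX.
Qed.

Lemma density_itv d X k : 0 < d -> gaps_at_least d X -> (1 <= k <= N)%N ->
  0 <= density X k <= (N%:R * d)^-1.
Proof.
move=> d0 dX kN; rewrite (density_le d0 (dX k kN)) andbT.
by rewrite /density invr_ge0 mulr_ge0 ?ler0n// ltW// (lt_le_trans d0) ?dX.
Qed.

Lemma gap_dist X Y k : `|gap X k - gap Y k| <= 2 * `|X - Y|.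
Proof.
have -> : gap X k - gap Y k =
    (X - Y) ord0 (inord k) - (X - Y) ord0 (inord k.-1).
  by rewrite /gap /position !mxE; ring.
rewrite (le_trans (ler_normB _ _))// mulr2n mulrDl mul1r.
by rewrite lerD// norm_coord_le.
Qed.

(** Here the lower bound on the gaps is essential: the derivative of [1 / (N g)]
    is at most [1 / (N d^2)] in absolute value for [g >= d]. *)
Lemma density_dist d X Y k : 0 < d -> d <= gap X k -> d <= gap Y k ->
  `|density X k - density Y k| <= 2 / (N%:R * d ^+ 2) * `|X - Y|.
Proof.
move=> d0 dX dY; rewrite /density.
set x := gap X k; set y := gap Y k.
have x0 : 0 < x by exact: lt_le_trans dX.
have y0 : 0 < y by exact: lt_le_trans dY.
have -> : (N%:R * x)^-1 - (N%:R * y)^-1 = (N%:R * (x * y))^-1 * (y - x).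
  by field; rewrite !gt_eqF.
rewrite normrM ger0_norm; last by rewrite invr_ge0 !mulr_ge0 ?ler0n// ltW.
rewrite mulrAC [leRHS]mulrC ler_pM//.
- by rewrite invr_ge0 !mulr_ge0 ?ler0n// ltW.
- rewrite lef_pV2 ?posrE ?mulr_gt0// ?exprn_gt0// ler_pM2l// expr2.
  by rewrite ler_pM// ltW.
- by rewrite distrC gap_dist.
Qed.

Lemma ftl_speed_inner v X k : (0 < k < N)%N ->
  ftl_speed v X k = interface_speed v (density X k) (density X k.+1).
Proof.
by case/andP=> k0 kN; rewrite /ftl_speed gtn_eqF// ltn_eqF.
Qed.

Lemma ftl_speed0 v X : ftl_speed v X 0 = min_on v 0 (density X 1).
Proof. by []. Qed.

Lemma ftl_speedN v X : ftl_speed v X N = max_on v 0 (density X N).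
Proof. by rewrite /ftl_speed gtn_eqF// eqxx. Qed.

Lemma ftl_speed_dist v L d X Y k : 0 <= L -> 0 < d ->
  lipschitz_to (N%:R * d)^-1 L v -> gaps_at_least d X -> gaps_at_least d Y ->
  (k <= N)%N ->
  `|ftl_speed v X k - ftl_speed v Y k| <=
    L * (2 / (N%:R * d ^+ 2) * `|X - Y|).
Proof.
move=> L0 d0 lipv dX dY kN; set e := _ * `|X - Y|.
have close j : (1 <= j <= N)%N -> `|density X j - density Y j| <= e.
  by move=> jN; apply: density_dist; rewrite ?dX ?dY.
have e0 : 0 <= e by apply: le_trans (close 1%N _).
have iX := density_itv d0 dX; have iY := density_itv d0 dY.
have [->|k0] := posnP k.
  have [/andP[? ?] /andP[? ?]] := (iX 1%N N1, iY 1%N N1).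
  rewrite !ftl_speed0; apply: (min_on_lipschitz L0 lipv) => //.
  - by rewrite subrr normr0.
  - exact: close.
have NN : (1 <= N <= N)%N by rewrite N1 leqnn.
have [->|kN'] := eqVneq k N.
  have [/andP[? ?] /andP[? ?]] := (iX N NN, iY N NN).
  rewrite !ftl_speedN; apply: (max_on_lipschitz L0 lipv) => //.
  - by rewrite subrr normr0.
  - exact: close.
have {kN'}kN' : (k < N)%N by rewrite ltn_neqAle kN'.
rewrite !ftl_speed_inner ?k0//.
by apply: (interface_speed_lipschitz L0 lipv);
  first [exact: iX|exact: iY|exact: close|
    apply: iX|apply: iY|apply: close]; rewrite ?k0 ?kN.
Qed.

(** Both speeds are extrema over an interval having the largest density as an
    end point: a minimum for the vehicle behind the gap, a maximum for the one
    in front of it. *)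
Lemma ftl_speed_at_densest v L d X k : 0 <= L -> 0 < d ->
  lipschitz_to (N%:R * d)^-1 L v -> gaps_at_least d X -> (1 <= k <= N)%N ->
  (forall j, (1 <= j <= N)%N -> density X j <= density X k) ->
  ftl_speed v X k.-1 <= v (density X k) <= ftl_speed v X k.
Proof.
move=> L0 d0 lipv dX kN dens; have /andP[k1 kN'] := kN.
have iX := density_itv d0 dX; have /andP[rk0 rkA] := iX k kN.
apply/andP; split.
- have [k1'|k1'] := leqP k 1.
    have -> : k = 1%N by apply/eqP; rewrite eqn_leq k1'.
    rewrite ftl_speed0; have /andP[? ?] := iX 1%N N1.
    by apply: (min_on_le L0 lipv) => //; apply/andP.
  have kp : (0 < k.-1 < N)%N by rewrite -ltnS prednK// k1' (leq_trans _ kN')//= prednK.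
  have kpN : (1 <= k.-1 <= N)%N by case/andP: kp => -> /ltnW.
  rewrite ftl_speed_inner// prednK//; have /andP[? ?] := iX _ kpN.
  rewrite /interface_speed.
  have [le_rr|/ltW le_rr] := leP (density X k) (density X k.-1).
    (* The maximum formula applies to the vehicle behind only in a tie, when the
       interval is a single point. *)
    have -> : density X k.-1 = density X k by apply: le_anti; rewrite le_rr dens.
    have [c /le_anti <- <-] := max_on_attained L0 lipv rk0 (lexx _) rkA.
    exact: lexx.
  by apply: (min_on_le L0 lipv) => //; rewrite lexx le_rr.
- have [->|kN''] := eqVneq k N.
    have /andP[? ?] : 0 <= density X N <= (N%:R * d)^-1.
      by apply: iX; rewrite N1 leqnn.
    by rewrite ftl_speedN; apply: (le_max_on L0 lipv) => //; apply/andP.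
  have {kN''}ltkN : (k < N)%N by rewrite ltn_neqAle kN''.
  have kS : (1 <= k.+1 <= N)%N by [].
  rewrite ftl_speed_inner ?k1// /interface_speed dens//.
  have /andP[? ?] := iX _ kS.
  by apply: (le_max_on L0 lipv) => //; rewrite lexx dens.
Qed.

(** Keeps [x_0] and widens every gap that is smaller than [d] to [d]: a Lipschitz
    retraction onto the states with gaps at least [d]. *)
Definition spread d X : 'rV[R]_N.+1 :=
  \row_k (position X 0 + \sum_(i < k) Num.max d (gap X i.+1)).

Lemma position_spread d X k : (k <= N)%N ->
  position (spread d X) k = position X 0 + \sum_(i < k) Num.max d (gap X i.+1).
Proof. by move=> kN; rewrite {1}/position mxE inordK. Qed.

Lemma gap_spread d X k : (1 <= k <= N)%N ->
  gap (spread d X) k = Num.max d (gap X k).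
Proof.
case: k => // k kN; rewrite /gap !position_spread//; last exact: ltnW.
by rewrite big_ord_recr/=; ring.
Qed.

Lemma gaps_at_least_spread d X : gaps_at_least d (spread d X).
Proof. by move=> k kN; rewrite gap_spread// le_max lexx. Qed.

Lemma spread_id d X : gaps_at_least d X -> spread d X = X.
Proof.
move=> dX; apply/rowP => k; rewrite !mxE.
have kN : (k <= N)%N by rewrite -ltnS.
have -> : \sum_(i < k) Num.max d (gap X i.+1) =
    \sum_(0 <= i < k) (position X i.+1 - position X i).
  rewrite big_mkord; apply: eq_bigr => i _; rewrite max_r// dX//=.
  exact: leq_trans (ltn_ord i) kN.
by rewrite telescope_sumr// addrC subrK /position inord_val.
Qed.

Lemma spread_dist d X Y : `|spread d X - spread d Y| <= (1 + 2 * N%:R) * `|X - Y|.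
Proof.
apply: norm_row_le => [|k]; first by rewrite mulr_ge0// addr_ge0// mulr_ge0.
rewrite !mxE mulrDl mul1r.
have -> : forall a b a' b' : R, a + b - (a' + b') = (a - a') + (b - b').
  by move=> *; ring.
rewrite (le_trans (ler_normD _ _))// lerD//.
  by have := norm_coord_le (X - Y) (inord 0); rewrite !mxE.
rewrite -sumrB (le_trans (ler_norm_sum _ _ _))//.
apply: (@le_trans _ _ (\sum_(i < k) 2 * `|X - Y|)).
  apply: ler_sum => i _; apply: le_trans (gap_dist X Y i.+1).
  have max_dist (x y : R) : `|Num.max d x - Num.max d y| <= `|x - y|.
    have := ler_norm (x - y); have := ler_norm (y - x); rewrite distrC => h1 h2.
    by rewrite ler_norml; case: (leP d x) => ?; case: (leP d y) => ?;
      apply/andP; split; lra.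
  exact: max_dist.
rewrite sumr_const card_ord -[_ *+ k]mulr_natl mulrA ler_wpM2r//.
by rewrite mulrC ler_pM2l// ler_nat -ltnS.
Qed.

Definition spread_field v d X : 'rV[R]_N.+1 :=
  \row_k ftl_speed v (spread d X) k.

Lemma spread_field_lipschitz v L d : 0 <= L -> 0 < d ->
  lipschitz_to (N%:R * d)^-1 L v ->
  exists2 M, 0 < M &
    forall X Y, `|spread_field v d X - spread_field v d Y| <= M * `|X - Y|.
Proof.
move=> L0 d0 lipv; pose c := 2 / (N%:R * d ^+ 2).
have c0 : 0 <= c by rewrite divr_ge0// mulr_ge0 ?ler0n// exprn_ge0// ltW.
have M0 : 0 <= L * (c * (1 + 2 * N%:R)).
  by rewrite mulr_ge0// mulr_ge0// addr_ge0// mulr_ge0.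
exists (L * (c * (1 + 2 * N%:R)) + 1); first by rewrite ltr_wpDl.
move=> X Y; apply: (@le_trans _ _ (L * (c * (1 + 2 * N%:R)) * `|X - Y|)); last first.
  by rewrite ler_wpM2r// lerDl.
apply: norm_row_le => [|k]; first by rewrite mulr_ge0.
rewrite !mxE; have kN : (k <= N)%N by rewrite -ltnS.
have := ftl_speed_dist L0 d0 lipv (gaps_at_least_spread d X)
  (gaps_at_least_spread d Y) kN.
move=> /le_trans; apply; rewrite -[leRHS]mulrA ler_wpM2l//.
rewrite -[leRHS]mulrA ler_wpM2l//.
exact: spread_dist.
Qed.

End FollowTheLeaderField.

(** * Derivatives relative to an interval, and a barrier principle *)

Section DerivativeWithin.
Variable R : realType.
Implicit Types (f : R -> R) (J : set R) (t l b : R).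

(** The difference quotient completed by the value [l] at [t] (Caratheodory):
    having derivative [l] becomes continuity of this function at [t], a form
    that does not depend on punctured neighbourhoods. *)
Definition slope f t l s : R :=
  if s == t then l else (s - t)^-1 * (f s - f t).

Lemma slopeE f t l s : f s - f t = slope f t l s * (s - t).
Proof.
rewrite /slope; have [->|st] := eqVneq s t; first by rewrite !subrr mulr0.
by rewrite mulrAC mulVf ?mul1r// subr_eq0.
Qed.

Lemma has_derivative_withinP J f t l :
  has_derivative_within J f t l <-> slope f t l @ within J (nbhs t) --> l.
Proof.
split=> fl P lP.
- have near_P : \forall s \near t, s != t -> J s ->
      P ((s - t)^-1 * (f s - f t)) by exact: fl P lP.
  have : \forall s \near t, J s -> P (slope f t l s) => //.
  apply: filterS near_P => s sP Js.
  rewrite /slope; case: eqVneq => [_|st]; first exact: nbhs_singleton.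
  exact: sP.
- have near_P : \forall s \near t, J s -> P (slope f t l s) by exact: fl P lP.
  have : \forall s \near t, s != t -> J s ->
      P ((s - t)^-1 * (f s - f t)) => //.
  apply: filterS near_P => s sP st Js; have := sP Js.
  by rewrite /slope (negbTE st).
Qed.

Lemma is_derive_slopeP f t l : is_derive t 1 f l <-> slope f t l @ t --> l.
Proof.
rewrite is_derive1_caratheodory; split=> [[g [gE gc gt]]|fl].
  suff -> : slope f t l = g by rewrite -[X in _ --> X]gt; exact: gc.
  apply/funext => s; rewrite /slope; case: eqVneq => [->//|st].
  by rewrite gE mulrC mulfK// subr_eq0.
exists (slope f t l); split; first by move=> s; exact: slopeE.
- by rewrite /prop_for /continuous_at {2}/slope eqxx.
- by rewrite /slope eqxx.
Qed.

Lemma has_derivative_within_of_derive J f t l :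
  is_derive t 1 f l -> has_derivative_within J f t l.
Proof.
move=> /is_derive_slopeP fl; apply/has_derivative_withinP.
exact: cvg_within_filter.
Qed.

Lemma is_derive_of_within J f t l : J° t ->
  has_derivative_within J f t l -> is_derive t 1 f l.
Proof.
move=> Jt /has_derivative_withinP fl; apply/is_derive_slopeP.
by rewrite within_interior in fl.
Qed.

Lemma continuous_of_within J f t l : has_derivative_within J f t l ->
  f @ within J (nbhs t) --> f t.
Proof.
move=> /has_derivative_withinP fl.
have -> : f = (fun s => f t + slope f t l s * (s - t)).
  by apply/funext => s; rewrite -slopeE addrC subrK.
have dt : (s - t) @[s --> within J (nbhs t)] --> t - t.
  apply: cvg_within_filter.
  by apply: (@cvgB _ _ _ _ _ id (cst t)); [exact: cvg_id|exact: cvg_cst].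
have := cvgD (cvg_cst (f t)) (cvgM fl dt).
by rewrite subrr !mulr0; apply.
Qed.

(** After the last time [c] at which [f >= d], the function would be
    nondecreasing, hence could not end below [f c >= d]. *)
Lemma barrier f df (d b : R) : 0 <= b -> d <= f 0 ->
  {within `[0, b], continuous f} ->
  (forall t, 0 < t < b -> is_derive t 1 f (df t)) ->
  (forall t, 0 < t < b -> f t < d -> 0 <= df t) -> d <= f b.
Proof.
move=> b0 df0 fc fd df_ge0; rewrite leNgt; apply/negP => fbd.
pose S := [set s | 0 <= s <= b /\ d <= f s].
have S0 : S 0 by split=> //; rewrite lexx.
have ubS : ubound S b by move=> s [/andP[]].
have supS : has_sup S by split; [exists 0|exists b].
pose c := sup S.
have c0 : 0 <= c by apply: ub_le_sup => //; exists b.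
have cb : c <= b by apply: ge_sup => //; exists 0.
have dfc : d <= f c.
  rewrite leNgt; apply/negP => fcd.
  have cI : `[0, b]%classic c by rewrite /= in_itv/= c0.
  have fcc := (subspace_continuousP _ _).1 fc c cI.
  have near_c : \forall s \near c, `[0, b]%classic s -> f s < d.
    exact: (@cvgr_lt _ _ _ (within_filter _ (nbhs_filter c)) _ _ fcc).
  have [e /= e0 He] := iffLR (nbhs_normP c _) near_c.
  have [s [/andP[s0 sb] dfs] cs] := sup_adherent e0 supS.
  have sc : s <= c by apply: ub_le_sup; [exists b|split; rewrite ?s0].
  have : f s < d; last by rewrite ltNge dfs.
  apply: He; last by rewrite /= in_itv/= s0.
  by rewrite /= ger0_norm ?subr_ge0// ltrBlDl -ltrBlDr.
have : f c <= f b; last by rewrite leNgt (lt_le_trans fbd).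
apply: (@ger0_derive_le_increment _ f df) => // [t /andP[ct tb]||t /andP[ct tb]].
- by apply: fd; rewrite tb (le_lt_trans c0).
- by apply: continuous_subspaceW fc; apply: subset_itvr; rewrite bnd_simp.
- have t0 := le_lt_trans c0 ct.
  apply: df_ge0; rewrite ?t0 ?tb// ltNge; apply/negP => dft.
  have : t <= c by apply: ub_le_sup; [exists b|split; rewrite ?(ltW t0) ?(ltW tb)].
  by rewrite leNgt ct.
Qed.

End DerivativeWithin.

(** * Global solution, uniqueness and the density bound *)

Section Solutions.
Variables (R : realType) (v : R -> R) (N : nat).
Hypothesis hv : [locally [lipschitz v x | x in `[0, +oo[%classic]].
Hypothesis N1 : (1 <= N)%N.
Implicit Types (X Y : R -> 'rV[R]_N.+1) (d b t T : R) (k : nat).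

Lemma spread_field_globally_lipschitz d : 0 < d ->
  exists2 M, 0 < M &
    forall x y : 'rV[R]_N.+1,
      `|spread_field v d x - spread_field v d y| <= M * `|x - y|.
Proof.
move=> d0; have [L L0 lipv] := lipschitz_compact (N%:R * d)^-1 hv.
exact: (spread_field_lipschitz N1 L0 d0 lipv).
Qed.

Lemma spread_field_on_gaps d (x : 'rV[R]_N.+1) (k : 'I_N.+1) :
  gaps_at_least d x -> spread_field v d x ord0 k = ftl_speed v x k.
Proof. by move=> dx; rewrite mxE spread_id. Qed.

(** In [spread d x] the gap [k] is exactly [d], the least possible value, so [k]
    is a place of maximal density. *)
Lemma small_gap_widens d (x : 'rV[R]_N.+1) k : 0 < d -> (1 <= k <= N)%N ->
  gap x k < d ->
  0 <= spread_field v d x ord0 (inord k) - spread_field v d x ord0 (inord k.-1).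
Proof.
move=> d0 kN small; have /andP[k1 kN'] := kN.
have [L L0 lipv] := lipschitz_compact (N%:R * d)^-1 hv.
have dx := gaps_at_least_spread d x.
have densest j : (1 <= j <= N)%N ->
    density (spread d x) j <= density (spread d x) k.
  move=> jN; rewrite {2}/density gap_spread// max_l ?(ltW small)//.
  by apply: (density_le N1 d0); exact: dx.
have /andP[lo hi] := ftl_speed_at_densest N1 L0 d0 lipv dx kN densest.
rewrite !mxE !inordK// ?ltnS//; last by rewrite (leq_trans (leq_pred k)).
by rewrite subr_ge0 (le_trans lo hi).
Qed.

(** By [barrier] the flow of the modified field never leaves the states on which
    the field was not modified. *)
Lemma ftl_flow d (x : 'rV[R]_N.+1) : 0 < d -> gaps_at_least d x ->
  exists X, [/\ X 0 = x, forall t, 0 <= t -> gaps_at_least d (X t) &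
    forall t (k : 'I_N.+1), 0 <= t ->
      is_derive t 1 (fun s => X s ord0 k) (ftl_speed v (X t) k)].
Proof.
move=> d0 dx; have [M M0 lipF] := spread_field_globally_lipschitz d0.
have [X [X0 Xd]] := velocity_field_flow M0 lipF x.
have dX t : 0 <= t -> gaps_at_least d (X t).
  move=> t0 k kN.
  pose dgap s := spread_field v d (X s) ord0 (inord k) -
                 spread_field v d (X s) ord0 (inord k.-1).
  have gapd (s : R) : 0 <= s -> is_derive s 1 (fun s => gap (X s) k) (dgap s).
    by move=> s0; apply: is_deriveB; exact: Xd.
  apply: (@barrier _ (fun s : R => gap (X s) k) dgap d t t0).
  - by rewrite X0; exact: dx.
  - apply: derivable_within_continuous => s /[!in_itv]/= /andP[s0 _].
    by have ? := gapd s s0; exact: ex_derive.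
  - by move=> s /andP[/ltW s0 _]; exact: gapd.
  - by move=> s _; exact: small_gap_widens.
exists X; split=> // t k t0; rewrite -(spread_field_on_gaps k (dX t t0)).
exact: Xd.
Qed.

Lemma ftl_solution_coord_continuous (x : 'rV[R]_N.+1) T Y b (k : 'I_N.+1) :
  b < T -> ftl_solution v x `[0, T[ Y ->
  {within `[0, b], continuous (fun s => Y s ord0 k)}.
Proof.
move=> bT [_ solY]; apply/subspace_continuousP => t /= /[!in_itv]/= /andP[t0 tb].
have tJ : `[0, T[%classic t by rewrite /= in_itv/= t0 (le_lt_trans tb).
have [_ /(_ k)] := solY t tJ; rewrite -ltnS => /(_ (ltn_ord k)).
rewrite /position inord_val => /continuous_of_within; apply: cvg_trans.
apply: cvg_app; apply: within_subset => s /=; rewrite !in_itv/=.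
by move=> /andP[-> sb]; rewrite (le_lt_trans sb).
Qed.

(** Makes a local solution an integral curve of a globally Lipschitz field on
    every compact interval, without any quantitative bound on its gaps. *)
Lemma ftl_solution_gap_lower_bound (x : 'rV[R]_N.+1) T Y b : 0 <= b -> b < T ->
  ftl_solution v x `[0, T[ Y ->
  exists2 d, 0 < d & forall t, 0 <= t <= b -> gaps_at_least d (Y t).
Proof.
move=> b0 bT solY.
have gap_bound (i : 'I_N) : exists m, 0 < m /\
    forall t, 0 <= t <= b -> m <= gap (Y t) i.+1.
  have gc : {within `[0, b], continuous (fun s => gap (Y s) i.+1)}.
    move=> s; apply: cvgB.
      exact: (@ftl_solution_coord_continuous x T Y b (inord i.+1) bT solY s).
    exact: (@ftl_solution_coord_continuous x T Y b (inord i) bT solY s).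
  have [c cI cmin] := EVT_min b0 gc.
  exists (gap (Y c) i.+1); split; last by move=> t tb; apply: cmin; rewrite in_itv.
  move: cI; rewrite in_itv/= => /andP[c0 cb].
  have cJ : `[0, T[%classic c by rewrite /= in_itv/= c0 (le_lt_trans cb).
  have [incY _] := solY.2 c cJ.
  by rewrite /gap subr_gt0; apply: incY; rewrite /= ltn_ord.
have [m Hm] := choice gap_bound.
exists (\big[Num.min/1]_i m i).
  elim/big_ind: _ => // [y z y0 z0|i _]; first by rewrite lt_min y0.
  by have [] := Hm i.
move=> t tb [|k] // kN; have [_ /(_ t tb)] := Hm (Ordinal kN).
by apply: le_trans; exact: bigmin_le.
Qed.

Lemma ftl_solution_unique d (x : 'rV[R]_N.+1) X T Y b :
  0 < d -> X 0 = x -> (forall t, 0 <= t -> gaps_at_least d (X t)) ->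
  (forall t (k : 'I_N.+1), 0 <= t ->
     is_derive t 1 (fun s => X s ord0 k) (ftl_speed v (X t) k)) ->
  0 <= b -> b < T -> ftl_solution v x `[0, T[ Y -> Y b = X b.
Proof.
move=> d0 X0 dX Xd b0 bT solY.
have [c c0 cY] := ftl_solution_gap_lower_bound b0 bT solY.
pose e := Num.min c d.
have e0 : 0 < e by rewrite lt_min c0.
have eY t : 0 <= t <= b -> gaps_at_least e (Y t).
  by move=> tb k kN; rewrite (le_trans _ (cY t tb k kN))// ge_min lexx.
have eX t : 0 <= t -> gaps_at_least e (X t).
  by move=> t0 k kN; rewrite (le_trans _ (dX t t0 k kN))// ge_min lexx orbT.
have [M M0 lipF] := spread_field_globally_lipschitz e0.
apply: (velocity_field_unique M0 lipF b0).
- by rewrite solY.1.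
- move=> k; split=> [|t /andP[t0 tb]].
    exact: ftl_solution_coord_continuous bT solY.
  rewrite /= spread_field_on_gaps; last by apply: eY; rewrite !ltW.
  have tJ : `[0, T[%classic t by rewrite /= in_itv/= ltW// (lt_trans tb).
  have [_ /(_ k)] := solY.2 t tJ; rewrite -ltnS => /(_ (ltn_ord k)).
  rewrite /position inord_val; apply: is_derive_of_within.
  rewrite /interior; have tI : t \in `]0, T[ by rewrite in_itv/= t0 (lt_trans tb).
  by apply: filterS (near_in_itvoo tI) => s; apply: subset_itv; rewrite bnd_simp.
- move=> k; split=> [|t /andP[t0 _]].
    apply: derivable_within_continuous => s /[!in_itv]/= /andP[s0 _].
    by have ? := Xd s k s0; exact: ex_derive.
  by rewrite /= (spread_field_on_gaps k (eX t (ltW t0))); exact: Xd (ltW t0).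
Qed.

End Solutions.

(** [g |-> 1 / (N g)] is decreasing on positive gaps, so it exchanges minima and
    maxima; positivity of the running minimum is carried through the induction. *)
Lemma bigmax_density (R : realType) (N : nat) (x : 'rV[R]_N.+1) :
  (1 <= N)%N -> increasing_state x ->
  0 < \big[Num.min/gap x 1]_(1 <= k < N.+1) gap x k /\
  \big[Num.max/density x 1]_(1 <= k < N.+1) density x k =
    (N%:R * \big[Num.min/gap x 1]_(1 <= k < N.+1) gap x k)^-1.
Proof.
move=> N1 incx; have gap_gt0 k : (1 <= k <= N)%N -> 0 < gap x k.
  by move=> kN; rewrite subr_gt0 incx.
have N0 : 0 < N%:R :> R by rewrite ltr0n.
rewrite big_nat [X in X = _]big_nat.
elim/big_rec2: _ => [|k _ r kN [r0 ->]].
  by split; first by apply: gap_gt0; rewrite N1.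
have xk := gap_gt0 k kN; split; first by rewrite lt_min xk.
rewrite /density; have [kr|rk] := leP (gap x k) r.
  by rewrite max_l// lef_pV2 ?posrE ?mulr_gt0// ler_pM2l.
by rewrite max_r// lef_pV2 ?posrE ?mulr_gt0// ler_pM2l// ltW.
Qed.

Theorem theorem2p1 (R : realType) (v : R -> R)
    (hv : [locally [lipschitz v x | x in `[0, +oo[%classic]])
    (N : nat) (hN : (1 <= N)%N)
    (X0 : 'rV[R]_N.+1) (hX0 : increasing_state X0) :
  let Rbar := \big[Num.max/density X0 1]_(1 <= k < N.+1) density X0 k in
  Rbar = (N%:R * \big[Num.min/gap X0 1]_(1 <= k < N.+1) gap X0 k)^-1 /\
  exists X : R -> 'rV[R]_N.+1,
    [/\ ftl_solution v X0 `[0, +oo[ X,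
        (forall (T : R) (Y : R -> 'rV[R]_N.+1), 0 < T ->
           ftl_solution v X0 `[0, T[ Y ->
           forall t : R, 0 <= t < T -> Y t = X t) &
        forall k : nat, (1 <= k <= N)%N ->
          forall t : R, 0 <= t -> density (X t) k <= Rbar].
Proof.
move=> Rbar; have [d0 RbarE] := bigmax_density hN hX0; split=> //.
rewrite /Rbar {}RbarE; set d := \big[Num.min/_]_(_ <= _ < _) _ in d0 *.
have dX0 : gaps_at_least d X0.
  by move=> k kN; apply: ge_bigmin_seq => //; rewrite mem_index_iota ltnS.
have [X [XX0 dX Xd]] := ftl_flow hv hN d0 dX0.
exists X; split.
- split=> // t; rewrite /= in_itv/= andbT => t0; split.
    by move=> k kN; rewrite -subr_gt0 (lt_le_trans d0)// dX.
  move=> k kN; apply: has_derivative_within_of_derive.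
  by have := Xd t (inord k) t0; rewrite inordK.
- move=> T Y _ solY t /andP[t0 tT].
  by apply: (ftl_solution_unique hv hN d0 XX0 dX Xd t0 tT solY).
- by move=> k kN t t0; apply: (density_le hN) => //; exact: dX.
Qed.
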